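(* There exist constants $c,\alpha,\beta>0$ such that for all sufficiently large $n$ and all $r\ge0$, $0<\epsilon\le 1$ and $R$ with $\epsilon<R$ and $c\sqrt{\log n}\le R\le\sqrt n$, with probability at least $1-1/n^2$ a graph drawn from the stationary distribution of the geometric-MEG $\mathcal{G}(n,r,R,\epsilon)$ is simultaneously an $(h,\alpha R^2/h)$-expander for every $1\le h\le\alpha R^2$ and an $(h,\beta R/\sqrt h)$-expander for every $\alpha R^2\le h\le n/2$.
   Context: $L_{n,\epsilon}=\{(i\epsilon,j\epsilon): i,j\in\mathbb{N},\ i,j\le\sqrt n/\epsilon\}$; $\Gamma(\mathbf{x})=\{\mathbf{y}\in L_{n,\epsilon}:d(\mathbf{x},\mathbf{y})\le r\}$ with $d$ Euclidean distance. Each node $i\in[n]$ has position $P_{i,t}\in L_{n,\epsilon}$ evolving independently as a Markov chain that moves from $\mathbf{x}$ to a uniform random point of $\Gamma(\mathbf{x})$. The geometric-MEG $\mathcal{G}(n,r,R,\epsilon)=\{G_t\}$ has $G_t=([n],E_t)$ with $E_t=\{\{i,j\}: d(P_{i,t},P_{j,t})\le R\}$. It is stationary when the initial positions are independent, each with the stationary law $\pi(\mathbf{x})=|\Gamma(\mathbf{x})|/\sum_{\mathbf{y}}|\Gamma(\mathbf{y})|$; the stationary distribution of $\mathcal{G}$ is the law of $G_0$ then. For $I\subseteq[n]$, $N(I)$ is the set of nodes outside $I$ adjacent to some node of $I$; a graph is an $(h,k)$-expander if every $I$ with $|I|\le h$ has $|N(I)|\ge k|I|$. *)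

(* Defs.v *)
From Stdlib Require Import Reals ZArith ClassicalEpsilon.
From mathcomp Require Import all_boot.
Set Implicit Arguments. Unset Strict Implicit. Unset Printing Implicit Defensive.

Local Open Scope R_scope.

Definition Rle_bool (a b : R) : bool := if Rle_dec a b then true else false.

Definition rsum {T : Type} (s : seq T) (f : T -> R) : R :=
  foldr (fun x acc => f x + acc) 0 s.
Definition rprod {T : Type} (s : seq T) (f : T -> R) : R :=
  foldr (fun x acc => f x * acc) 1 s.

Definition indic (P : Prop) : R :=
  if excluded_middle_informative P then 1 else 0.

(* M = floor(sqrt n / eps): indices i with i in N and i <= sqrt n / eps
   are exactly 0..M *)
Definition latM (n : nat) (eps : R) : nat :=
  Z.to_nat (Int_part (sqrt (INR n) / eps)).

(* L_{n,eps} indexed by pairs (i,j), the point being (i*eps, j*eps) *)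
Definition Lat (n : nat) (eps : R) : finType :=
  ('I_(latM n eps).+1 * 'I_(latM n eps).+1)%type.

Definition coord1 {n : nat} {eps : R} (x : Lat n eps) : R := INR (nat_of_ord x.1) * eps.
Definition coord2 {n : nat} {eps : R} (x : Lat n eps) : R := INR (nat_of_ord x.2) * eps.

Definition dist {n : nat} {eps : R} (x y : Lat n eps) : R :=
  sqrt ((coord1 x - coord1 y) ^ 2 + (coord2 x - coord2 y) ^ 2).

Definition Gamma {n : nat} {eps : R} (r : R) (x : Lat n eps) : {set Lat n eps} :=
  [set y : Lat n eps | Rle_bool (dist x y) r].

Definition pi_stat {n : nat} {eps : R} (r : R) (x : Lat n eps) : R :=
  INR #|Gamma r x| / rsum (enum (Lat n eps)) (fun y => INR #|Gamma r y|).

Definition Config (n : nat) (eps : R) : finType := {ffun 'I_n -> Lat n eps}.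

(* probability that the independent stationary positions P_{i,0} ~ pi
   form a configuration satisfying E *)
Definition stat_prob (n : nat) (r eps : R) (E : Config n eps -> Prop) : R :=
  rsum (enum (Config n eps))
    (fun P => rprod (enum 'I_n) (fun i => pi_stat r (P i)) * indic (E P)).

Arguments stat_prob n r eps E : clear implicits.

Definition adj {n : nat} {eps : R} (Rad : R) (P : Config n eps) (i j : 'I_n) : bool :=
  (i != j) && Rle_bool (dist (P i) (P j)) Rad.

Definition nbhd {n : nat} {eps : R} (Rad : R) (P : Config n eps) (I : {set 'I_n})
  : {set 'I_n} :=
  [set j | (j \notin I) && [exists i in I, adj Rad P i j]].

Definition expander {n : nat} {eps : R} (Rad : R) (P : Config n eps) (h : nat) (k : R)
  : Prop :=
  forall I : {set 'I_n}, (#|I| <= h)%N -> k * INR #|I| <= INR #|nbhd Rad P I|.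

(* Main.v *)
(* Cut the lattice into square cells of side between R/12 and R/3, small enough
   that nodes in equal or king-adjacent cells are within distance R. Folding and
   halving displacements gives |Gamma(x)| <= 16 |Gamma(y)|, so pi is within a
   factor 16 of uniform and every cell has mass between R^2/(9216 n) and 2R^2/n.
   Exponential moments and a union bound over the at most n cells show that, with
   probability at least 1 - 1/n^2, every cell holds between lo = R^2/36864 and
   hi = 5R^2 nodes. The rest is deterministic. One cell met by I already gives lo
   neighbours. For large I, let A be the set of cells met by I and D the size of
   its boundary: every node outside I lying in A, and every node of a boundary
   cell, is a neighbour of I. Either the former number at least n/4, or both A
   and its complement have at least |I|/(2 hi) cells; the grid isoperimetric
   inequality min(|A|, |A^c|) <= D^2 then gives |N(I)| >= lo * D, which is at
   least of order R sqrt|I|. *)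
Require Import Defs.
From Stdlib Require Import Reals ZArith ClassicalEpsilon.
From HB Require Import structures.
From mathcomp Require Import all_boot.
From Stdlib Require Import Classical Lra Psatz.
From mathcomp Require Import zify.
Set Implicit Arguments. Unset Strict Implicit. Unset Printing Implicit Defensive.

Local Open Scope R_scope.

(** * Sums, products and exponential moments *)

HB.instance Definition _ := Monoid.isComLaw.Build R 0 Rplus
  (fun x y z => esym (Rplus_assoc x y z)) Rplus_comm Rplus_0_l.
HB.instance Definition _ := Monoid.isComLaw.Build R 1 Rmult
  (fun x y z => esym (Rmult_assoc x y z)) Rmult_comm Rmult_1_l.
HB.instance Definition _ := Monoid.isMulLaw.Build R 0 Rmult
  Rmult_0_l Rmult_0_r.
HB.instance Definition _ := Monoid.isAddLaw.Build R Rmult Rplus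
  Rmult_plus_distr_r Rmult_plus_distr_l.

Lemma rsumE (T : finType) (f : T -> R) :
  rsum (enum T) f = \big[Rplus/0]_x f x.
Proof.
rewrite /rsum -[RHS]big_enum /=.
by elim: (enum T) => [|a l IH]; rewrite ?big_nil ?big_cons /= ?IH.
Qed.

Lemma rprodE (T : finType) (f : T -> R) :
  rprod (enum T) f = \big[Rmult/1]_x f x.
Proof.
rewrite /rprod -[RHS]big_enum /=.
by elim: (enum T) => [|a l IH]; rewrite ?big_nil ?big_cons /= ?IH.
Qed.

Lemma big_Rplus_le (I : Type) (s : seq I) (P : pred I) (f g : I -> R) :
  (forall i, P i -> f i <= g i) ->
  \big[Rplus/0]_(i <- s | P i) f i <= \big[Rplus/0]_(i <- s | P i) g i.
Proof. move=> H; elim/big_rec2: _ => [|i x y Pi]; [lra|have := H i Pi; lra]. Qed.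

Lemma big_Rplus_const (I : finType) (A : {set I}) (a : R) :
  \big[Rplus/0]_(i in A) a = INR #|A| * a.
Proof.
rewrite -sum1_card; elim/big_rec2: _ => [|i x y _ ->]; first by rewrite /= Rmult_0_l.
rewrite add1n S_INR; ring.
Qed.

Lemma big_Rplus_constT (I : finType) (a : R) :
  \big[Rplus/0]_(i : I) a = INR #|I| * a.
Proof. by rewrite -cardsT -big_Rplus_const; apply: eq_bigl => i; rewrite inE. Qed.

Lemma big_Rmult_const (n : nat) (a : R) : \big[Rmult/1]_(i < n) a = a ^ n.
Proof. by elim: n => [|n IH]; rewrite ?big_ord0 // big_ord_recl IH. Qed.

Lemma big_Rmult_ge0 (I : finType) (f : I -> R) :
  (forall i, 0 <= f i) -> 0 <= \big[Rmult/1]_i f i.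
Proof. by move=> H; elim/big_rec: _ => [|i x _ Hx]; [lra|apply: Rmult_le_pos]. Qed.

Lemma big_Rplus_ge0 (I : Type) (s : seq I) (P : pred I) (f : I -> R) :
  (forall i, 0 <= f i) -> 0 <= \big[Rplus/0]_(i <- s | P i) f i.
Proof. by move=> H; elim/big_rec: _ => [|i x _]; [lra|have := H i; lra]. Qed.

Lemma sumn_lower_bound (I : finType) (B : {set I}) (F : I -> nat) (lo : R) :
  (forall i, lo <= INR (F i)) -> lo * INR #|B| <= INR (\sum_(i in B) F i).
Proof.
move=> H; rewrite -sum1_card; elim/big_rec2: _ => [|i x y _ IH]; first by rewrite /=; lra.
rewrite add1n S_INR plus_INR; have := H i; lra.
Qed.

Lemma sumn_upper_bound (I : finType) (B : {set I}) (F : I -> nat) (hi : R) :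
  (forall i, INR (F i) <= hi) -> INR (\sum_(i in B) F i) <= hi * INR #|B|.
Proof.
move=> H; rewrite -sum1_card; elim/big_rec2: _ => [|i x y _ IH]; first by rewrite /=; lra.
rewrite add1n S_INR plus_INR; have := H i; lra.
Qed.

Lemma exp_INR_mult (n : nat) (x : R) : exp (INR n * x) = exp x ^ n.
Proof.
elim: n => [|n IH]; first by rewrite /= Rmult_0_l exp_0.
by rewrite S_INR Rmult_plus_distr_r exp_plus IH Rmult_1_l /= Rmult_comm.
Qed.

(** * Independent nodes and the exponential moments of an occupancy count *)

Section ProductMeasure.
Variables (T : finType) (n : nat) (w : T -> R).
Hypothesis w_ge0 : forall x, 0 <= w x.
Hypothesis w_sum1 : \big[Rplus/0]_x w x = 1.

Definition prod_weight (P : {ffun 'I_n -> T}) : R := \big[Rmult/1]_i w (P i).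

Definition hits (A : {set T}) (P : {ffun 'I_n -> T}) : nat :=
  #|[set i | P i \in A]|.

Lemma prod_weight_ge0 P : 0 <= prod_weight P.
Proof. exact: big_Rmult_ge0. Qed.

(** Independence of the nodes: distributing the [n]-fold product of one-node sums gives a sum over
    all configurations. *)
Lemma expect_prod (g : T -> R) :
  \big[Rplus/0]_P (prod_weight P * \big[Rmult/1]_i g (P i))
  = (\big[Rplus/0]_x (w x * g x)) ^ n.
Proof.
rewrite -big_Rmult_const bigA_distr_bigA /=.
by apply: eq_bigr => P _; rewrite big_split.
Qed.

Lemma prod_weight_sum1 : \big[Rplus/0]_P prod_weight P = 1.
Proof.
rewrite -[RHS](pow1 n) -w_sum1 -big_Rmult_const bigA_distr_bigA /=.
by apply: eq_bigr.
Qed.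

Lemma exp_hits (A : {set T}) (t : R) P :
  exp (t * INR (hits A P)) = \big[Rmult/1]_i (if P i \in A then exp t else 1).
Proof.
rewrite /hits -sum1_card.
under eq_bigl do rewrite inE.
rewrite big_mkcond /=.
elim/big_rec2: _ => [|i x y _ <-]; first by rewrite /= Rmult_0_r exp_0.
case: ifP => _; rewrite ?add0n ?Rmult_1_l //.
by rewrite add1n S_INR -exp_plus; congr exp; ring.
Qed.

(** The count is a sum of [n] independent indicators of mean [p], so its transform is the [n]-th
    power of [1 + (exp t - 1) * p], and [1 + x <= exp x]. Both signs of [t] are covered. *)
Lemma hits_mgf (A : {set T}) (t : R) :
  \big[Rplus/0]_P (prod_weight P * exp (t * INR (hits A P)))
  <= exp (INR n * ((exp t - 1) * \big[Rplus/0]_(x in A) w x)).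
Proof.
under eq_bigr do rewrite exp_hits.
rewrite (expect_prod (fun x => if x \in A then exp t else 1)).
set p := \big[Rplus/0]_(x in A) w x.
have -> : \big[Rplus/0]_x (w x * (if x \in A then exp t else 1))
          = 1 + (exp t - 1) * p.
  rewrite -[X in _ = X + _]w_sum1 /p [\big[Rplus/0]_(x in A) _]big_mkcond big_distrr /= -big_split /=.
  by apply: eq_bigr => x _; case: ifP => _; ring.
have p_le1 : p <= 1.
  rewrite -w_sum1 /p big_mkcond; apply: big_Rplus_le => x _.
  by case: ifP => _; [lra|exact: w_ge0].
have p_ge0 : 0 <= p by exact: big_Rplus_ge0.
have e_pos := exp_pos t.
(* Monotonicity of the power needs a nonnegative base; for [t < 0] this comes from [p <= 1]. *)
rewrite exp_INR_mult; apply: pow_incr; split; first nra.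
exact: exp_ineq1_le.
Qed.
End ProductMeasure.

(** * Isoperimetry and expansion on a grid of cells *)

Definition near (u v : nat) : bool := ((u <= v.+1) && (v <= u.+1))%N.

Definition grid_near (K : nat) (x y : 'I_K * 'I_K) : bool :=
  near x.1 y.1 && near x.2 y.2.

Definition grid_boundary (K : nat) (A : {set 'I_K * 'I_K}) : {set 'I_K * 'I_K} :=
  [set y | (y \notin A) && [exists x in A, grid_near x y]].

Lemma near_refl u : near u u.
Proof. rewrite /near; lia. Qed.

Lemma grid_near_refl K (x : 'I_K * 'I_K) : grid_near x x.
Proof. by rewrite /grid_near !near_refl. Qed.

(** A discrete intermediate value principle, by induction on the distance from [i] to [j]: one step
    from [i] towards [j] either leaves [f], or shortens the distance. *)
Lemma nonconstant_near (K : nat) (f : pred 'I_K) (i j : 'I_K) :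
  f i -> ~~ f j -> exists a b : 'I_K, [/\ f a, ~~ f b & near a b].
Proof.
have [d] := ubnP (maxn i j - minn i j).
elim: d i j => // d IH i j lt_d fi nfj.
have neq : i != j :> nat by apply: contraNneq nfj => /val_inj <-.
have [near_ij | far] := boolP (near i j); first by exists i, j.
have : exists k : 'I_K, near i k /\ (maxn k j - minn k j < maxn i j - minn i j)%N.
  have [lt_ij|le_ji] := ltnP i j.
    have k_lt : (i.+1 < K)%N by have := ltn_ord j; lia.
    by exists (Ordinal k_lt); rewrite /near /=; split; lia.
  have k_lt : (i.-1 < K)%N by have := ltn_ord i; lia.
  by exists (Ordinal k_lt); rewrite /near /=; split; lia.
case=> k [near_ik lt_k].
have [fk|nfk] := boolP (f k); last by exists i, k.
by apply: (IH k j) => //; lia.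
Qed.

Section Isoperimetry.
Variables (K : nat) (A : {set 'I_K * 'I_K}).

Let mixed_rows := [set i | [exists j, (i, j) \in A] && [exists j, (i, j) \notin A]].
Let mixed_cols := [set j | [exists i, (i, j) \in A] && [exists i, (i, j) \notin A]].

(** Along a mixed row the colour changes between two near cells, and the one outside [A] is a
    boundary cell. So the boundary projects onto a superset of the mixed rows. *)
Let mixed_rows_le : (#|mixed_rows| <= #|grid_boundary A|)%N.
Proof.
apply: leq_trans (leq_imset_card fst _); apply/subset_leq_card/subsetP => i.
rewrite inE => /andP[/existsP[j jA] /existsP[k kA]].
have [a [b [aA bA ab]]] := @nonconstant_near _ (fun j => (i, j) \in A) _ _ jA kA.
apply/imsetP; exists (i, b) => //; rewrite inE bA /=; apply/existsP; exists (i, a).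
by rewrite aA /grid_near near_refl.
Qed.

Let mixed_cols_le : (#|mixed_cols| <= #|grid_boundary A|)%N.
Proof.
apply: leq_trans (leq_imset_card snd _); apply/subset_leq_card/subsetP => j.
rewrite inE => /andP[/existsP[i iA] /existsP[k kA]].
have [a [b [aA bA ab]]] := @nonconstant_near _ (fun i => (i, j) \in A) _ _ iA kA.
apply/imsetP; exists (b, j) => //; rewrite inE bA /=; apply/existsP; exists (a, j).
by rewrite aA /grid_near near_refl andbT.
Qed.

Let le_sq (B : {set 'I_K * 'I_K}) : B \subset setX mixed_rows mixed_cols ->
  (#|B| <= #|grid_boundary A| ^ 2)%N.
Proof.
move=> /subset_leq_card; rewrite cardsX => /leq_trans; apply.
by rewrite -mulnn; apply: leq_mul.
Qed.

(* If some row and some column are both unmixed, they meet, so all unmixed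
   lines are of one colour and the other colour lives in mixed lines only. *)
Lemma grid_isoperimetry :
  (#|A| <= #|grid_boundary A| ^ 2)%N \/ (#|~: A| <= #|grid_boundary A| ^ 2)%N.
Proof.
have all_mixed (m : {set 'I_K}) : (#|m| <= #|grid_boundary A|)%N ->
    (m = setT) -> (#|A| <= #|grid_boundary A| ^ 2)%N.
  move=> + mT; rewrite mT cardsT card_ord => le_K.
  apply: leq_trans (max_card _) _; rewrite card_prod card_ord.
  by rewrite -mulnn; apply: leq_mul.
have [/eqP rT|] := boolP (mixed_rows == setT); first by left; apply: all_mixed rT.
rewrite eqEsubset subsetT /= => /subsetPn[i _ i_unm].
have [/eqP cT|] := boolP (mixed_cols == setT); first by left; apply: all_mixed cT.
rewrite eqEsubset subsetT /= => /subsetPn[j _ j_unm].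
have row_const a b : ((i, a) \in A) = ((i, b) \in A).
  apply/idP/idP => H; apply: contraR i_unm => H'; rewrite inE; apply/andP; split;
    apply/existsP; by [exists a | exists b].
have col_const a b : ((a, j) \in A) = ((b, j) \in A).
  apply/idP/idP => H; apply: contraR j_unm => H'; rewrite inE; apply/andP; split;
    apply/existsP; by [exists a | exists b].
(* Row [i] and column [j] both carry the colour of their crossing. A cell of the other colour lies
   on a row and a column that each meet this cross, hence are mixed. *)
have [ijA|ijA] := boolP ((i, j) \in A).
  right; apply: le_sq; apply/subsetP => -[a b]; rewrite !inE /= => abA.
  apply/andP; split; apply/andP; split; apply/existsP;
    by [exists j; rewrite (col_const _ i) | exists b
       | exists i; rewrite (row_const _ j) | exists a].
left; apply: le_sq; apply/subsetP => -[a b]; rewrite !inE /= => abA.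
apply/andP; split; apply/andP; split; apply/existsP;
    by [exists j; rewrite (col_const _ i) | exists b
       | exists i; rewrite (row_const _ j) | exists a].
Qed.
End Isoperimetry.

(** * Vertex expansion from occupancy bounds on the cells *)

Section CellExpansion.
Variables (V : finType) (e : rel V) (K : nat) (pos : V -> 'I_K * 'I_K) (lo hi : R).
Hypothesis adjP : forall u v, u != v -> grid_near (pos u) (pos v) -> e u v.
Hypothesis lo_cell : forall c, lo <= INR #|[set v | pos v == c]|.
Hypothesis hi_cell : forall c, INR #|[set v | pos v == c]| <= hi.

Let nb (I : {set V}) := [set j | (j \notin I) && [exists i in I, e i j]].

Let card_cells (B : {set 'I_K * 'I_K}) :
  #|[set v | pos v \in B]| = (\sum_(c in B) #|[set v | pos v == c]|)%N.
Proof.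
rewrite -sum1_card (partition_big pos (mem B)) /=; last by move=> v; rewrite inE.
apply: eq_bigr => c cB; rewrite -sum1_card; apply: eq_bigl => v; rewrite !inE.
by case: eqP => [->|_]; rewrite ?cB ?andbF.
Qed.

Let sub_nb (I : {set V}) v i : i \in I -> v \notin I ->
  grid_near (pos i) (pos v) -> v \in nb I.
Proof.
move=> iI vI near_iv; rewrite inE vI /=; apply/existsP; exists i; rewrite iI /=.
by apply: adjP => //; apply: contraNneq vI => <-.
Qed.

Lemma small_set_expansion (I : {set V}) i : i \in I ->
  lo - INR #|I| <= INR #|nb I|.
Proof.
move=> iI; have : ([set v | pos v == pos i] \subset I :|: nb I).
  apply/subsetP => v; rewrite inE => /eqP pv; rewrite in_setU.
  have [//|vI] := boolP (v \in I).
  by apply: sub_nb iI vI _; rewrite pv grid_near_refl.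
move=> /subset_leq_card /leq_trans /(_ (leq_card_setU _ _)) /leP /le_INR.
rewrite plus_INR; have := lo_cell (pos i); lra.
Qed.

(** The second alternative combines [|N(I)| >= lo * D] with [|I| <= 2 * hi * D^2]; its squared form
    keeps square roots out of the counting. *)
Lemma large_set_expansion (I : {set V}) : 0 <= lo -> 0 <= hi -> INR #|I| <= INR #|V| / 2 ->
  INR #|V| / 4 <= INR #|nb I| \/
  lo ^ 2 * INR #|I| <= 2 * hi * INR #|nb I| ^ 2.
Proof.
move=> lo_ge0 hi_ge0 I_half.
set A := pos @: I; set D := #|grid_boundary A|.
set X := [set v | (v \notin I) && (pos v \in A)].
have X_nb : (#|X| <= #|nb I|)%N.
  apply/subset_leq_card/subsetP => v; rewrite inE => /andP[vI /imsetP[i iI pv]].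
  by apply: sub_nb iI vI _; rewrite pv grid_near_refl.
have D_nb : lo * INR D <= INR #|nb I|.
  apply: Rle_trans (le_INR _ _ _); first exact: sumn_lower_bound lo_cell.
  rewrite -card_cells; apply/leP/subset_leq_card/subsetP => v; rewrite inE.
  rewrite inE => /andP[vA /existsP[_ /andP[/imsetP[i iI ->] near_iv]]].
  apply: sub_nb iI _ near_iv; apply: contra vA; exact: imset_f.
have I_A : INR #|I| <= hi * INR #|A|.
  apply: Rle_trans (sumn_upper_bound _ hi_cell); apply: le_INR.
  rewrite -card_cells; apply/leP/subset_leq_card/subsetP => v vI.
  by rewrite inE imset_f.
(* A node is in [I], or outside [I] in a cell of [A], or in a cell that [I] misses. *)
have V_le : INR #|V| <= INR #|I| + INR #|X| + hi * INR #|~: A|.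
  have := sumn_upper_bound (~: A) hi_cell; rewrite -card_cells.
  set Z := [set v | _] => Z_le.
  have : [set: V] \subset I :|: X :|: Z.
    apply/subsetP => v _; rewrite !inE.
    by case: (v \in I); case: (pos v \in A).
  move=> /subset_leq_card; rewrite cardsT.
  move=> /leq_trans /(_ (leq_card_setU _ _)).
  have UX := leq_of_leqif (leq_card_setU I X) => VX.
  have /leP/le_INR : (#|V| <= #|I| + #|X| + #|Z|)%N by rewrite (leq_trans VX) ?leq_add2r.
  rewrite !plus_INR; lra.
have [|small] := Rle_lt_dec (INR #|V| / 4) (INR #|nb I|); [by left|right].
have /le_INR X_nbR := leP X_nb.
(* If isoperimetry bounds [A], then [I_A] suffices. If it bounds the complement, [|I| <= |V|/2] and
   [|X| < |V|/4] leave [|V|/4 <= hi * D^2], which is where the factor 2 arises. *)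
have key : INR #|I| <= 2 * hi * INR D ^ 2.
  have pI := pos_INR #|I|.
  have pow2 : INR (D ^ 2) = INR D ^ 2 by rewrite -mulnn mult_INR /=; ring.
  case: (grid_isoperimetry A) => /leP/le_INR; rewrite -/D pow2 => isop.
    have /(Rle_trans _ _ _ I_A) := Rmult_le_compat_l _ _ _ hi_ge0 isop; lra.
  have cA : hi * INR #|~: A| <= hi * INR D ^ 2 by apply: Rmult_le_compat_l.
  have := Rle_trans _ _ _ V_le (Rplus_le_compat_l _ _ _ cA); lra.
have pD := pos_INR D.
have sq : (lo * INR D) ^ 2 <= INR #|nb I| ^ 2 by apply: pow_incr; split => //; nra.
have := Rmult_le_compat_l _ _ _ (pow2_ge_0 lo) key.
have := Rmult_le_compat_l _ _ _ hi_ge0 sq; nra.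
Qed.
End CellExpansion.

(** * The stationary law and the cells *)

Lemma Rle_boolP a b : reflect (a <= b) (Rle_bool a b).
Proof. by rewrite /Rle_bool; case: Rle_dec => H; constructor. Qed.

(** The difference of [maxn] and [minn] is the absolute difference in [nat], free of truncation and
    accessible to [lia]. *)
Lemma sqr_INR_sub (a b : nat) :
  (INR a - INR b) ^ 2 = INR (maxn a b - minn a b) ^ 2.
Proof.
have [le_ba|/ltnW le_ab] := leqP b a; rewrite minus_INR; try lia; first by [].
ring.
Qed.

Lemma sqr_coord_le (a b c d : nat) (eps : R) :
  (maxn a b - minn a b <= maxn c d - minn c d)%N ->
  (INR a * eps - INR b * eps) ^ 2 <= (INR c * eps - INR d * eps) ^ 2.
Proof.
move=> /leP/le_INR le.
rewrite -!Rmult_minus_distr_r !Rpow_mult_distr !sqr_INR_sub.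
apply: Rmult_le_compat_r; first exact: pow2_ge_0.
by apply: pow_incr; split=> //; apply: pos_INR.
Qed.

(* Halving the displacement [d <= M] guarantees that one of the two
   directions from [y] stays inside [0..M]. *)
Definition half_step (M y d : nat) : nat :=
  if (y + d./2 <= M)%N then (y + d./2)%N else (y - d./2)%N.

(** The two bits keep what halving forgets: the side of [x] on which [z] lies and the parity of the
    displacement. *)
Definition fold_coord (M : nat) (x y z : 'I_M.+1) : (bool * bool) * 'I_M.+1 :=
  let d := (maxn x z - minn x z)%N in
  (x <= z, odd d, inord (half_step M y d))%N.

Lemma half_step_le M y d : (y <= M)%N -> (half_step M y d <= M)%N.
Proof. by rewrite /half_step; case: ifP => ?; lia. Qed.

(** The image is at least [y] for a forward step and below [y] for a backward one, and a backward
    step never truncates at 0. So the image determines the half displacement, and the bits then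
    recover [z]. *)
Lemma fold_coord_inj M (x y : 'I_M.+1) : injective (fold_coord x y).
Proof.
move=> z z' [sgn par /(congr1 val)] /=.
have xM := ltn_ord x; have yM := ltn_ord y; have zM := ltn_ord z; have z'M := ltn_ord z'.
rewrite !inordK ?ltnS ?half_step_le // => step; apply: val_inj => /=.
move: step; rewrite /half_step; case: ifP => ?; case: ifP => ?; lia.
Qed.

Lemma fold_coord_dist M (x y z : 'I_M.+1) :
  (maxn y (fold_coord x y z).2 - minn y (fold_coord x y z).2
   <= maxn x z - minn x z)%N.
Proof.
have xM := ltn_ord x; have yM := ltn_ord y; have zM := ltn_ord z.
rewrite /= inordK ?ltnS ?half_step_le //.
rewrite /half_step; case: ifP => ?; lia.
Qed.

Section Stationary.
Variables (n : nat) (eps r : R).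
Hypothesis r_ge0 : 0 <= r.

(** Folding both coordinates does not increase displacements, so it injects the ball around [x] into
    the ball around [y] times four bits. *)
Lemma card_Gamma_le (x y : Lat n eps) : (#|Gamma r x| <= 16 * #|Gamma r y|)%N.
Proof.
pose f (z : Lat n eps) := let u := fold_coord x.1 y.1 z.1 in
  let v := fold_coord x.2 y.2 z.2 in ((u.1, v.1), ((u.2, v.2) : Lat n eps)).
have f_inj : injective f.
  move=> [z1 z2] [t1 t2] e; congr pair.
    by apply: (@fold_coord_inj _ x.1 y.1); apply: (congr1 (fun p => (p.1.1, p.2.1)) e).
  by apply: (@fold_coord_inj _ x.2 y.2); apply: (congr1 (fun p => (p.1.2, p.2.2)) e).
rewrite -(card_imset _ f_inj).
have -> : 16%N = #|[set: (bool * bool) * (bool * bool)]|.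
  by rewrite cardsT !card_prod card_bool.
rewrite -cardsX; apply/subset_leq_card/subsetP => _ /imsetP[z zG ->].
rewrite in_setX inE /= inE; move: zG; rewrite inE => /Rle_boolP zr.
apply/Rle_boolP; apply: Rle_trans zr; apply: sqrt_le_1_alt; apply: Rplus_le_compat;
  apply: sqr_coord_le; exact: fold_coord_dist.
Qed.

Lemma card_Gamma_gt0 (x : Lat n eps) : 1 <= INR #|Gamma r x|.
Proof.
apply: (le_INR 1); apply/leP; apply/card_gt0P; exists x; rewrite inE; apply/Rle_boolP.
by rewrite /Defs.dist (_ : _ + _ = 0) ?sqrt_0 //; ring.
Qed.

Let total := \big[Rplus/0]_(y : Lat n eps) INR #|Gamma r y|.

Let total_gt0 : 0 < total.
Proof.
have : \big[Rplus/0]_(y : Lat n eps) 1 <= total.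
  by apply: big_Rplus_le => y _; apply: card_Gamma_gt0.
rewrite big_Rplus_constT card_prod card_ord => H.
by apply: Rlt_le_trans H; rewrite Rmult_1_r; apply: lt_0_INR; lia.
Qed.

Lemma pi_statE (x : Lat n eps) : pi_stat r x = INR #|Gamma r x| / total.
Proof. by rewrite /pi_stat rsumE. Qed.

Lemma pi_stat_ge0 (x : Lat n eps) : 0 <= pi_stat r x.
Proof.
rewrite pi_statE; apply: Rmult_le_pos; first exact: pos_INR.
exact/Rlt_le/Rinv_0_lt_compat.
Qed.

Lemma pi_stat_sum1 : \big[Rplus/0]_(x : Lat n eps) pi_stat r x = 1.
Proof.
under eq_bigr do rewrite pi_statE.
rewrite -big_distrl /= -/total; apply: Rinv_r; lra.
Qed.

Lemma pi_stat_le (x y : Lat n eps) : pi_stat r x <= 16 * pi_stat r y.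
Proof.
rewrite !pi_statE -Rmult_assoc; apply: Rmult_le_compat_r.
  exact/Rlt_le/Rinv_0_lt_compat.
have /leP/le_INR := card_Gamma_le x y; rewrite mult_INR (INR_IZR_INZ 16) /=; lra.
Qed.

(** Comparison with the uniform law: sum [pi_stat_le] over [x] in [C] and over all [y], whose total
    mass is 1. *)
Lemma pi_stat_set_le (C : {set Lat n eps}) :
  \big[Rplus/0]_(x in C) pi_stat r x * INR #|Lat n eps| <= 16 * INR #|C|.
Proof.
rewrite -[X in _ <= X]Rmult_1_r -{1}pi_stat_sum1 (Rmult_comm 16) Rmult_assoc.
rewrite [16 * _]big_distrr /= -big_Rplus_const big_distrl /=.
apply: big_Rplus_le => x _; rewrite Rmult_comm -big_Rplus_constT.
by apply: big_Rplus_le => y _; apply: pi_stat_le.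
Qed.

Lemma pi_stat_set_ge (C : {set Lat n eps}) :
  INR #|C| <= 16 * (\big[Rplus/0]_(x in C) pi_stat r x * INR #|Lat n eps|).
Proof.
rewrite -[X in X <= _]Rmult_1_r -{1}pi_stat_sum1 -big_Rplus_const.
rewrite big_distrl big_distrr /=; apply: big_Rplus_le => x _.
rewrite -Rmult_assoc Rmult_comm -big_Rplus_constT.
by apply: big_Rplus_le => y _; apply: pi_stat_le.
Qed.
End Stationary.

(** * Division of the lattice into square cells *)

Section Cells.
Variables (M q K : nat).
Hypothesis q_gt0 : (0 < q)%N.
Hypothesis KM : (K.+1 * q <= M.+1 < K.+2 * q)%N.

(* The last interval absorbs the remainder, so the [K.+1] intervals have
   lengths in [q, 2q). *)
Definition interval_of (v : nat) : 'I_K.+1 := inord (minn (v %/ q) K).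

Lemma interval_of_bounds v : (v <= M)%N ->
  (interval_of v * q <= v < (interval_of v).+2 * q)%N.
Proof.
move=> vM; rewrite /interval_of inordK; last by rewrite ltnS geq_minr.
apply/andP; split; first by rewrite -leq_divRL // geq_minl.
have [le|lt] := leqP (v %/ q) K; last by move: KM; lia.
by apply: leq_trans (ltn_ceil v q_gt0) _; rewrite leq_mul2r; lia.
Qed.

Lemma interval_of_add (c : 'I_K.+1) j : (j < q)%N -> interval_of (c * q + j) = c.
Proof.
move=> jq; apply: val_inj; rewrite /= inordK; last by rewrite ltnS geq_minr.
by rewrite divnMDl // divn_small // addn0; have := ltn_ord c; lia.
Qed.

Lemma card_interval_ge (c : 'I_K.+1) :
  (q <= #|[set v : 'I_M.+1 | interval_of v == c]|)%N.
Proof.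
have lt_M (j : 'I_q) : (c * q + j < M.+1)%N.
  case/andP: KM => [le _]; apply: leq_trans le.
  have := leq_mul2r q c.+1 K.+1; rewrite ltn_ord orbT => cK.
  by apply: leq_trans cK; rewrite mulSn addnC ltn_add2r.
pose f (j : 'I_q) := Ordinal (lt_M j).
have f_inj : injective f by move=> i j [] /addnI /val_inj.
rewrite -{1}(card_ord q) -cardsT -(card_imset _ f_inj); apply: subset_leq_card.
by apply/subsetP => _ /imsetP[j _ ->]; rewrite inE interval_of_add.
Qed.

Lemma card_interval_le (c : 'I_K.+1) :
  (#|[set v : 'I_M.+1 | interval_of v == c]| <= 2 * q)%N.
Proof.
pose g (v : 'I_M.+1) : 'I_(2 * q).-1.+1 := inord (v - c * q).
rewrite -[leqRHS]prednK ?muln_gt0 // -[leqRHS]card_ord; apply: (@leq_card_in _ _ g).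
have bnd v : v \in [set v : 'I_M.+1 | interval_of v == c] ->
    (c * q <= v < c * q + 2 * q)%N.
  rewrite inE => /eqP <-; have := interval_of_bounds (ltn_ord v : (v <= M)%N); lia.
move=> v w /bnd bv /bnd bw /(congr1 val) /=.
rewrite !inordK; [|lia|lia] => e; apply: val_inj => /=; lia.
Qed.

(** Each interval lies within [2 * q] of its left end, and near intervals have left ends at most [q]
    apart. *)
Lemma near_interval_dist (v w : nat) : (v <= M)%N -> (w <= M)%N ->
  near (interval_of v) (interval_of w) -> (maxn v w - minn v w <= 3 * q)%N.
Proof. move=> /interval_of_bounds bv /interval_of_bounds bw; rewrite /near; nia. Qed.

Definition cell_of (x : 'I_M.+1 * 'I_M.+1) : 'I_K.+1 * 'I_K.+1 :=
  (interval_of x.1, interval_of x.2).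

Lemma cell_fiberE c : [set x | cell_of x == c] =
  setX [set v : 'I_M.+1 | interval_of v == c.1] [set v : 'I_M.+1 | interval_of v == c.2].
Proof. by apply/setP => x; rewrite !inE. Qed.

Lemma card_cell_ge c : (q ^ 2 <= #|[set x | cell_of x == c]|)%N.
Proof. by rewrite cell_fiberE cardsX -mulnn leq_mul ?card_interval_ge. Qed.

Lemma card_cell_le c : (#|[set x | cell_of x == c]| <= 4 * q ^ 2)%N.
Proof.
by rewrite cell_fiberE cardsX -[4%N]/(2 ^ 2)%N -expnMn -mulnn leq_mul ?card_interval_le.
Qed.
End Cells.

(** Each coordinate differs by at most [3 * q * eps], and [9 + 9 <= 36]. *)
Lemma cell_of_dist (n K q : nat) (eps : R) (x y : Lat n eps) :
  (0 < q)%N -> (K.+1 * q <= (latM n eps).+1 < K.+2 * q)%N -> 0 < eps ->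
  grid_near (cell_of q K x) (cell_of q K y) -> Defs.dist x y <= 6 * INR q * eps.
Proof.
move=> q_gt0 KM eps_gt0 /andP[near1 near2].
have q_ge0 := pos_INR q.
have sq (v w : 'I_(latM n eps).+1) : near (interval_of q K v) (interval_of q K w) ->
    (INR v * eps - INR w * eps) ^ 2 <= 9 * (INR q * eps) ^ 2.
  move=> vw; have := near_interval_dist q_gt0 KM (ltn_ord v : v <= _)%N (ltn_ord w : w <= _)%N vw.
  move=> le; have := @sqr_coord_le v w (3 * q) 0 eps.
  rewrite maxn0 minn0 subn0 => /(_ le) sq_le.
  by apply: Rle_trans sq_le _; rewrite mult_INR /=; right; ring.
rewrite -(sqrt_pow2 (6 * INR q * eps)); last by have := Rmult_le_pos _ _ q_ge0 (Rlt_le _ _ eps_gt0); lra.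
apply: sqrt_le_1_alt.
apply: Rle_trans (Rplus_le_compat _ _ _ _ (sq _ _ near1) (sq _ _ near2)) _.
have := pow2_ge_0 (INR q * eps); lra.
Qed.

Lemma nat_floor_bounds x : 0 <= x ->
  INR (Z.to_nat (Int_part x)) <= x < INR (Z.to_nat (Int_part x)) + 1.
Proof.
move=> x_ge0; have [le gt] := base_Int_part x.
have ip_ge0 : (0 <= Int_part x)%Z.
  have : (-1 < Int_part x)%Z by apply: lt_IZR; lra.
  lia.
rewrite INR_IZR_INZ Z2Nat.id //; lra.
Qed.

(** * Concentration *)

Lemma exp_le_compat (x y : R) : x <= y -> exp x <= exp y.
Proof. by case=> [/exp_increasing/Rlt_le|->] //; apply: Rle_refl. Qed.

Lemma Rdiv_le_1 (x y : R) : 0 < y -> x <= y -> x / y <= 1.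
Proof.
move=> y_gt0 xy; apply: (Rmult_le_reg_r y) => //.
by rewrite /Rdiv Rmult_assoc Rinv_l ?Rmult_1_r ?Rmult_1_l //; lra.
Qed.

Section Concentration.
Variables (T : finType) (n : nat) (w : T -> R).
Hypothesis w_ge0 : forall x, 0 <= w x.
Hypothesis w_sum1 : \big[Rplus/0]_x w x = 1.

(** The exponential moment at [t = 1], with [exp 1 - 1 <= 2]. *)
Lemma expect_exp_hits_sub (A : {set T}) (hi nu : R) :
  INR n * \big[Rplus/0]_(x in A) w x <= nu ->
  \big[Rplus/0]_P (prod_weight w P * exp (INR (@hits T n A P) - hi)) <= exp (2 * nu - hi).
Proof.
move=> le_nu.
have -> : \big[Rplus/0]_P (prod_weight w P * exp (INR (@hits T n A P) - hi)) =
  exp (- hi) * \big[Rplus/0]_(P : {ffun 'I_n -> T}) (prod_weight w P * exp (1 * INR (hits A P))).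
  rewrite big_distrr /=; apply: eq_bigr => P _.
  by rewrite Rmult_1_l /Rminus exp_plus; ring.
have -> : exp (2 * nu - hi) = exp (- hi) * exp (2 * nu) by rewrite -exp_plus; congr exp; ring.
apply: Rmult_le_compat_l; first exact/Rlt_le/exp_pos.
apply: Rle_trans (@hits_mgf T n w w_ge0 w_sum1 A 1) _; apply: exp_le_compat.
set p := \big[Rplus/0]_(x in A) w x in le_nu *.
have p_ge0 : 0 <= p by exact: big_Rplus_ge0.
have np_ge0 : 0 <= INR n * p by apply: Rmult_le_pos => //; apply: pos_INR.
have := exp_le_3; nra.
Qed.

(** The exponential moment at [t = -1], with [exp (-1) - 1 <= -1/2]. *)
Lemma expect_exp_sub_hits (A : {set T}) (lo mu : R) :
  mu <= INR n * \big[Rplus/0]_(x in A) w x ->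
  \big[Rplus/0]_P (prod_weight w P * exp (lo - INR (@hits T n A P))) <= exp (lo - mu / 2).
Proof.
move=> ge_mu.
have -> : \big[Rplus/0]_P (prod_weight w P * exp (lo - INR (@hits T n A P))) =
  exp lo * \big[Rplus/0]_(P : {ffun 'I_n -> T}) (prod_weight w P * exp (-1 * INR (hits A P))).
  rewrite big_distrr /=; apply: eq_bigr => P _.
  rewrite /Rminus exp_plus (_ : -1 * _ = - INR (hits A P)); ring.
have -> : exp (lo - mu / 2) = exp lo * exp (- mu / 2) by rewrite -exp_plus; congr exp; field.
apply: Rmult_le_compat_l; first exact/Rlt_le/exp_pos.
apply: Rle_trans (@hits_mgf T n w w_ge0 w_sum1 A (-1)) _; apply: exp_le_compat.
set p := \big[Rplus/0]_(x in A) w x in ge_mu *.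
have p_ge0 : 0 <= p by exact: big_Rplus_ge0.
have np_ge0 : 0 <= INR n * p by apply: Rmult_le_pos => //; apply: pos_INR.
have inv_e : exp (-1) <= / 2.
  rewrite (_ : -1 = - (1)) // exp_Ropp; apply: Rinv_le_contravar; first lra.
  have := exp_ineq1_le 1; lra.
nra.
Qed.

Lemma cell_concentration (G : finType) (cell : T -> G) (mu nu lo hi : R)
    (E : {ffun 'I_n -> T} -> Prop) :
  (forall c, mu <= INR n * \big[Rplus/0]_(x in [set x | cell x == c]) w x <= nu) ->
  (forall P, (forall c, lo <= INR (hits [set x | cell x == c] P) <= hi) -> E P) ->
  1 - INR #|G| * (exp (2 * nu - hi) + exp (lo - mu / 2))
  <= \big[Rplus/0]_P (prod_weight w P * indic (E P)).
Proof.
move=> mass good.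
pose H c := @hits T n [set x | cell x == c].
(* Markov's inequality and the union bound in one function: a count outside [[lo, hi]] makes one of
   these exponentials at least 1, so [bad] dominates the indicator of failure. *)
pose bad P := \big[Rplus/0]_c (exp (INR (H c P) - hi) + exp (lo - INR (H c P))).
have term_ge0 P c : 0 <= exp (INR (H c P) - hi) + exp (lo - INR (H c P)).
  by apply/Rlt_le/Rplus_lt_0_compat; apply: exp_pos.
have bad_ge P c : exp (INR (H c P) - hi) + exp (lo - INR (H c P)) <= bad P.
  rewrite /bad (bigD1 c) //=.
  set S := \big[Rplus/0]_(i | _) _; suff : 0 <= S by lra.
  exact: big_Rplus_ge0.
have bad_ge0 P : 0 <= bad P by exact: big_Rplus_ge0.
have pointwise P : 1 <= indic (E P) + bad P.
  rewrite /indic; case: (excluded_middle_informative (E P)) => /= [?|nE]; first by have := bad_ge0 P; lra.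
  have /not_all_ex_not [c nc] : ~ forall c, lo <= INR (H c P) <= hi.
    by move=> all; apply: nE; apply: good.
  have := bad_ge P c.
  have := exp_ineq1_le (INR (H c P) - hi); have := exp_ineq1_le (lo - INR (H c P)).
  have := exp_pos (INR (H c P) - hi); have := exp_pos (lo - INR (H c P)).
  have [|] := Rle_lt_dec lo (INR (H c P)); last lra.
  have [|] := Rle_lt_dec (INR (H c P)) hi; last lra.
  by move=> *; case: nc.
have bad_mean : \big[Rplus/0]_P (prod_weight w P * bad P)
    <= INR #|G| * (exp (2 * nu - hi) + exp (lo - mu / 2)).
  under eq_bigr do rewrite big_distrr.
  rewrite exchange_big -big_Rplus_constT /=; apply: big_Rplus_le => c _.
  under eq_bigr do rewrite Rmult_plus_distr_l.
  rewrite big_split /=; apply: Rplus_le_compat.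
    by apply: expect_exp_hits_sub; case: (mass c).
  by apply: expect_exp_sub_hits; case: (mass c).
have : \big[Rplus/0]_(P : {ffun 'I_n -> T}) prod_weight w P <=
    \big[Rplus/0]_P (prod_weight w P * indic (E P)) +
    \big[Rplus/0]_P (prod_weight w P * bad P).
  rewrite -big_split /=; apply: big_Rplus_le => P _.
  have := Rmult_le_compat_l _ _ _ (prod_weight_ge0 w_ge0 P) (pointwise P); lra.
rewrite prod_weight_sum1 //; lra.
Qed.
End Concentration.

(** * Expansion of balanced configurations *)

Section Deterministic.
Variables (n q K : nat) (eps Rad : R) (P : Config n eps).
Hypothesis q_gt0 : (0 < q)%N.
Hypothesis KM : (K.+1 * q <= (latM n eps).+1 < K.+2 * q)%N.
Hypothesis eps_gt0 : 0 < eps.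
Hypothesis q_Rad : 6 * INR q * eps <= Rad.
Hypothesis Rad_gt0 : 0 < Rad.
Hypothesis balanced : forall c,
  Rad ^ 2 / 36864 <= INR (hits [set x | cell_of q K x == c] P) <= 5 * Rad ^ 2.

Let pos i := cell_of q K (P i).

Let hitsE c : hits [set x | cell_of q K x == c] P = #|[set i | pos i == c]|.
Proof. by apply: eq_card => i; rewrite !inE. Qed.

Let adjP u v : u != v -> grid_near (pos u) (pos v) -> adj Rad P u v.
Proof.
move=> uv near_uv; rewrite /adj uv; apply/Rle_boolP.
exact: Rle_trans (cell_of_dist q_gt0 KM eps_gt0 near_uv) q_Rad.
Qed.

Let lo_cell c : Rad ^ 2 / 36864 <= INR #|[set i | pos i == c]|.
Proof. by rewrite -hitsE; case: (balanced c). Qed.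

Let hi_cell c : INR #|[set i | pos i == c]| <= 5 * Rad ^ 2.
Proof. by rewrite -hitsE; case: (balanced c). Qed.

Lemma balanced_small (I : {set 'I_n}) i : i \in I -> INR #|I| <= Rad ^ 2 / 73728 ->
  Rad ^ 2 / 73728 <= INR #|nbhd Rad P I|.
Proof.
move=> iI le.
have : Rad ^ 2 / 36864 - INR #|I| <= INR #|nbhd Rad P I|.
  exact: small_set_expansion adjP lo_cell _ _ iI.
lra.
Qed.

(** The constant is [147456 = 4 * 36864]: the boundary case loses a factor [2 * 5 = 10] from [hi],
    and [10 <= 4^2]. Sets of size at most [lo / 2] are settled by [balanced_small]. *)
Lemma balanced_large (I : {set 'I_n}) i : i \in I -> INR #|I| <= INR n / 2 ->
  (Rad / 147456) ^ 2 * INR #|I| <= INR #|nbhd Rad P I| ^ 2.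
Proof.
move=> iI I_half.
have R2_gt0 : 0 < Rad ^ 2 by apply: pow_lt.
have m_ge0 := pos_INR #|I|.
have [small|large] := Rle_lt_dec (INR #|I|) (Rad ^ 2 / 73728).
  have N_ge := balanced_small iI small.
  have : (Rad ^ 2 / 73728) ^ 2 <= INR #|nbhd Rad P I| ^ 2 by apply: pow_incr; lra.
  nra.
have lo_ge0 : 0 <= Rad ^ 2 / 36864 by lra.
have hi_ge0 : 0 <= 5 * Rad ^ 2 by lra.
have : INR n / 4 <= INR #|nbhd Rad P I| \/
    (Rad ^ 2 / 36864) ^ 2 * INR #|I| <= 2 * (5 * Rad ^ 2) * INR #|nbhd Rad P I| ^ 2.
  have := @large_set_expansion _ _ _ _ _ _ adjP lo_cell hi_cell I lo_ge0 hi_ge0.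
  by rewrite card_ord; apply.
set m := INR #|I| in m_ge0 I_half large *; set N := INR #|nbhd Rad P I|.
case=> [N_big|N_big].
  have : (m / 2) ^ 2 <= N ^ 2 by apply: pow_incr; lra.
  nra.
have : Rad ^ 2 * ((Rad / 147456) ^ 2 * m) <= Rad ^ 2 * N ^ 2 by nra.
exact: Rmult_le_reg_l.
Qed.

Lemma balanced_expander_small (h : nat) : 1 <= INR h -> INR h <= / 73728 * Rad ^ 2 ->
  expander Rad P h (/ 73728 * Rad ^ 2 / INR h).
Proof.
move=> h_ge1 h_le I Ih; have /leP/le_INR mh := Ih.
have [->|/set0Pn[i iI]] := eqVneq I set0; first by rewrite cards0 /= Rmult_0_r; apply: pos_INR.
have N_ge := @balanced_small I i iI ltac:(lra).
apply: Rle_trans N_ge.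
have m_ge0 := pos_INR #|I|.
have R2_ge0 := pow2_ge_0 Rad.
have : INR #|I| / INR h <= 1 by apply: Rdiv_le_1; lra.
have -> : / 73728 * Rad ^ 2 / INR h * INR #|I| = Rad ^ 2 / 73728 * (INR #|I| / INR h).
  by field; lra.
nra.
Qed.

(** The square root of [balanced_large] gives order [Rad * sqrt |I|], and [|I| <= h] turns
    [sqrt |I|] into at least [|I| / sqrt h]. *)
Lemma balanced_expander_large (h : nat) : INR h <= INR n / 2 ->
  expander Rad P h (/ 147456 * Rad / sqrt (INR h)).
Proof.
move=> h_le I Ih; have /leP/le_INR mh := Ih.
have [->|/set0Pn[i iI]] := eqVneq I set0; first by rewrite cards0 /= Rmult_0_r; apply: pos_INR.
have m_gt0 : 0 < INR #|I|.
  by apply: lt_0_INR; apply/ltP/card_gt0P; exists i.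
have sq := @balanced_large I i iI ltac:(lra).
have sm_gt0 := sqrt_lt_R0 _ m_gt0.
have smh := sqrt_le_1_alt _ _ mh.
have smm := sqrt_sqrt _ (Rlt_le _ _ m_gt0).
have N_ge0 := pos_INR #|nbhd Rad P I|.
apply: (@Rle_trans _ (Rad / 147456 * sqrt (INR #|I|))).
  have -> : / 147456 * Rad / sqrt (INR h) * INR #|I| =
      Rad / 147456 * sqrt (INR #|I|) * (sqrt (INR #|I|) / sqrt (INR h)).
    by rewrite -{1}smm; field; lra.
  rewrite -[X in _ <= X]Rmult_1_r; apply: Rmult_le_compat_l; first nra.
  by apply: Rdiv_le_1; lra.
apply: Rsqr_incr_0 => //; last nra.
by rewrite Rsqr_mult Rsqr_sqrt ?Rsqr_pow2 //; lra.
Qed.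
End Deterministic.

(** * Choice of the cell size, cell masses and the final estimate *)

Lemma stat_probE (n : nat) (r eps : R) (E : Config n eps -> Prop) :
  stat_prob n r eps E =
  \big[Rplus/0]_P (prod_weight (@pi_stat n eps r) P * indic (E P)).
Proof. by rewrite /stat_prob rsumE; apply: eq_bigr => P _; rewrite rprodE. Qed.

Lemma cell_scale (n : nat) (eps Rad : R) :
  0 < eps -> eps <= 1 -> 1 <= INR n -> 24 <= Rad -> Rad <= sqrt (INR n) ->
  exists q K : nat,
  [/\ (0 < q)%N, (K.+1 * q <= (latM n eps).+1 < K.+2 * q)%N,
      6 * INR q * eps <= Rad, (K.+1 * K.+1 <= n)%N &
      INR n * INR q ^ 2 <= Rad ^ 2 / 36 * INR (latM n eps).+1 ^ 2 /\
      Rad ^ 2 * INR (latM n eps).+1 ^ 2 <= 576 * (INR n * INR q ^ 2)].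
Proof.
move=> eps_gt0 eps_le1 n_ge1 R_ge R_le.
have sn_ge1 : 1 <= sqrt (INR n) by lra.
have snn := sqrt_sqrt _ (Rle_trans _ _ _ Rle_0_1 n_ge1).
set sn := sqrt (INR n) in R_le sn_ge1 snn.
have ie_ge1 : 1 <= / eps by rewrite -{1}Rinv_1; apply: Rinv_le_contravar.
have x_ge : 1 <= sn * / eps by nra.
(* A real number that is at least 1 loses at most half of itself to its floor; this gives the
   factors 2 in [qe_lo] and [Me_hi]. *)
have y_ge : 4 <= Rad / 6 * / eps by nra.
have [|s_lo s_hi] := @nat_floor_bounds (sn * / eps); first by lra.
rewrite -/(latM n eps) in s_lo s_hi.
pose q := Z.to_nat (Int_part (Rad / 6 * / eps)).
have [|q_lo q_hi] := @nat_floor_bounds (Rad / 6 * / eps); first by lra.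
rewrite -/q in q_lo q_hi.
set M := latM n eps in s_lo s_hi *.
have e_eps : / eps * eps = 1 by rewrite Rinv_l //; lra.
have qe_hi : 6 * (INR q * eps) <= Rad.
  have := Rmult_le_compat_r _ _ _ (Rlt_le _ _ eps_gt0) q_lo.
  rewrite Rmult_assoc e_eps; lra.
have qe_lo : Rad <= 12 * (INR q * eps).
  have : Rad / 6 * / eps <= 2 * INR q by lra.
  move=> /(Rmult_le_compat_r _ _ _ (Rlt_le _ _ eps_gt0)).
  rewrite (Rmult_assoc _ _ eps) e_eps; lra.
have Me_lo : sn <= INR M.+1 * eps.
  have : sn * / eps <= INR M.+1 by rewrite S_INR; lra.
  move=> /(Rmult_le_compat_r _ _ _ (Rlt_le _ _ eps_gt0)).
  rewrite (Rmult_assoc _ _ eps) e_eps; lra.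
have Me_hi : INR M.+1 * eps <= 2 * sn.
  have : INR M.+1 <= 2 * (sn * / eps) by rewrite S_INR; lra.
  move=> /(Rmult_le_compat_r _ _ _ (Rlt_le _ _ eps_gt0)).
  rewrite !(Rmult_assoc _ _ eps) e_eps; lra.
have q_gt0 : (0 < q)%N by apply/ltP/INR_lt; rewrite /=; lra.
have q_le : (q <= M.+1)%N.
  apply/leP/INR_le; apply: (Rmult_le_reg_r eps) => //; lra.
have K_gt0 : (0 < M.+1 %/ q)%N by rewrite divn_gt0.
have KM : ((M.+1 %/ q).-1.+1 * q <= M.+1 < (M.+1 %/ q).-1.+2 * q)%N.
  by rewrite prednK // leq_trunc_div ltn_ceil.
exists q, (M.+1 %/ q).-1; split => //; first by lra.
- set K := (M.+1 %/ q).-1.+1 in KM *; case/andP: KM => /leP/le_INR + _.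
  rewrite mult_INR => /(Rmult_le_compat_r _ _ _ (Rlt_le _ _ eps_gt0)) Kq.
  have K_ge0 := pos_INR K.
  apply/leP/INR_le; rewrite mult_INR -snn.
  (* [K] cells of side at least [Rad / 12] fit in a length of at most [2 * sn]; with [Rad >= 24] at
     most [sn] of them lie along each axis. *)
  have K_Rad : INR K * Rad <= 24 * sn.
    have := Rmult_le_compat_l _ _ _ K_ge0 qe_lo; lra.
  have : INR K <= sn by nra.
  move=> ?; apply: Rmult_le_compat; lra.
split.
- apply: (Rmult_le_reg_r (eps ^ 2)); first by apply: pow_lt.
  rewrite -snn.
  have -> : sn * sn * INR q ^ 2 * eps ^ 2 = (sn * (INR q * eps)) ^ 2 by ring.
  have -> : Rad ^ 2 / 36 * INR M.+1 ^ 2 * eps ^ 2 = (INR M.+1 * eps * (Rad / 6)) ^ 2 by field.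
  apply: pow_incr; split; first by nra.
  by apply: Rmult_le_compat; lra.
apply: (Rmult_le_reg_r (eps ^ 2)); first by apply: pow_lt.
rewrite -snn.
have -> : 576 * (sn * sn * INR q ^ 2) * eps ^ 2 = (12 * (INR q * eps) * (2 * sn)) ^ 2 by ring.
have -> : Rad ^ 2 * INR M.+1 ^ 2 * eps ^ 2 = (Rad * (INR M.+1 * eps)) ^ 2 by ring.
apply: pow_incr; split; first by nra.
by apply: Rmult_le_compat; lra.
Qed.

(** A cell has between [q^2] and [4 * q^2] lattice points, and the law is within 16 of uniform:
    [9216 = 16 * 576] below, and [16 * 4 / 36 <= 2] above. *)
Lemma cell_mass (n q K : nat) (r eps Rad : R) (c : 'I_K.+1 * 'I_K.+1) :
  0 <= r -> (0 < q)%N -> (K.+1 * q <= (latM n eps).+1 < K.+2 * q)%N ->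
  INR n * INR q ^ 2 <= Rad ^ 2 / 36 * INR (latM n eps).+1 ^ 2 ->
  Rad ^ 2 * INR (latM n eps).+1 ^ 2 <= 576 * (INR n * INR q ^ 2) ->
  Rad ^ 2 / 9216 <= INR n * \big[Rplus/0]_(x in [set x : Lat n eps | cell_of q K x == c]) pi_stat r x
    <= 2 * Rad ^ 2.
Proof.
move=> r_ge0 q_gt0 KM up low.
set C := [set x : Lat n eps | _].
have := pi_stat_set_le r_ge0 C; have := pi_stat_set_ge r_ge0 C.
have /leP/le_INR C_ge : (q ^ 2 <= #|C|)%N := card_cell_ge q_gt0 KM c.
have /leP/le_INR C_le : (#|C| <= 4 * q ^ 2)%N := card_cell_le q_gt0 KM c.
rewrite mult_INR in C_le.
have q2 : INR (q ^ 2) = INR q ^ 2 by rewrite -mulnn mult_INR /=; ring.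
have i4 : INR 4 = 4 by rewrite /=; ring.
rewrite q2 i4 in C_ge C_le.
have -> : INR #|Lat n eps| = INR (latM n eps).+1 ^ 2.
  by rewrite card_prod card_ord mult_INR (_ : forall x, x ^ 2 = x * x) // => x; ring.
set p := \big[Rplus/0]_(x in C) _; set L := INR (latM n eps).+1 ^ 2 in up low *.
have n_ge0 := pos_INR n.
have L_gt0 : 0 < L by apply: pow_lt; apply: lt_0_INR; lia.
set Q := INR q ^ 2 in up low C_ge C_le *.
move=> p_ge p_le.
have ge1 : INR n * Q <= INR n * (16 * (p * L)) by apply: Rmult_le_compat_l => //; lra.
have le1 : INR n * (p * L) <= INR n * (64 * Q) by apply: Rmult_le_compat_l => //; lra.
split; apply: (Rmult_le_reg_r L) => //; first lra.
have := pow2_ge_0 Rad; nra.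
Qed.

Theorem mainTheorem7 :
  exists c alpha beta : R, 0 < c /\ 0 < alpha /\ 0 < beta /\
  exists n0 : nat, forall n : nat, (n0 <= n)%nat ->
  forall r eps Rad : R,
    0 <= r -> 0 < eps -> eps <= 1 -> eps < Rad ->
    c * sqrt (ln (INR n)) <= Rad -> Rad <= sqrt (INR n) ->
    stat_prob n r eps
      (fun P =>
         (forall h : nat, 1 <= INR h -> INR h <= alpha * Rad ^ 2 ->
            expander Rad P h (alpha * Rad ^ 2 / INR h)) /\
         (forall h : nat, alpha * Rad ^ 2 <= INR h -> INR h <= INR n / 2 ->
            expander Rad P h (beta * Rad / sqrt (INR h))))
    >= 1 - 1 / (INR n) ^ 2.
Proof.
(* [384^2 = 4 * 36864] makes [lo = Rad^2 / 36864] at least [4 * ln n]; [alpha * Rad^2] is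
   [lo / 2]. *)
exists 384, (/ 73728), (/ 147456); do 3 (split; first lra).
(* From [n >= 3 >= exp 1] follows [ln n >= 1], hence [Rad >= 384], which covers the bound 24 of
   [cell_scale]. *)
exists 3%N => n /leP/le_INR n_ge r eps Rad r_ge0 eps_gt0 eps_le1 _ R_ge R_le.
have {}n_ge : 3 <= INR n by move: n_ge; rewrite /=; lra.
have ln_ge1 : 1 <= ln (INR n).
  apply: Rnot_lt_le => /exp_increasing; rewrite exp_ln; last lra.
  have := exp_le_3; lra.
have sl_ge1 : 1 <= sqrt (ln (INR n)) by rewrite -sqrt_1; apply: sqrt_le_1_alt.
have sl_sq := sqrt_sqrt (ln (INR n)) ltac:(lra).
have R_ge24 : 24 <= Rad by lra.
have R_gt0 : 0 < Rad by lra.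
have R2_ge : 4 * ln (INR n) <= Rad ^ 2 / 36864.
  have : (384 * sqrt (ln (INR n))) ^ 2 <= Rad ^ 2 by apply: pow_incr; lra.
  nra.
have [q [K [q_gt0 KM q_Rad K_n [up low]]]] :=
  @cell_scale n eps Rad eps_gt0 eps_le1 ltac:(lra) R_ge24 R_le.
apply: Rle_ge; set E := fun P : Config n eps => _; rewrite stat_probE.
have good (P : Config n eps) : (forall c, Rad ^ 2 / 36864 <=
    INR (hits [set x | cell_of q K x == c] P) <= 5 * Rad ^ 2) -> E P.
  move=> bal; split=> h.
    exact: (balanced_expander_small q_gt0 KM eps_gt0 q_Rad bal).
  by move=> _; apply: (balanced_expander_large q_gt0 KM eps_gt0 q_Rad R_gt0 bal).
have := @cell_concentration _ n _ (@pi_stat_ge0 n eps r r_ge0) (@pi_stat_sum1 n eps r r_ge0) _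
  _ _ _ _ _ _ (fun c => cell_mass c r_ge0 q_gt0 KM up low) good.
apply: Rle_trans.
have n4 : exp (- (4 * ln (INR n))) = / INR n ^ 4.
  rewrite exp_Ropp; congr (/ _).
  rewrite (_ : 4 = INR 4); last by rewrite /=; ring.
  by rewrite exp_INR_mult exp_ln //; lra.
(* The exponents in [e1] and [e2] are [-Rad^2] and [-Rad^2 / 36864], both at most [-4 * ln n]. At
   most [n] cells with two tails each then fail with total probability at most [2 / n^3]. *)
have e1 : exp (2 * (2 * Rad ^ 2) - 5 * Rad ^ 2) <= / INR n ^ 4.
  by rewrite -n4; apply: exp_le_compat; lra.
have e2 : exp (Rad ^ 2 / 36864 - Rad ^ 2 / 9216 / 2) <= / INR n ^ 4.
  by rewrite -n4; apply: exp_le_compat; lra.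
have G_n : INR #|{: 'I_K.+1 * 'I_K.+1}| <= INR n.
  by apply: le_INR; apply/leP; rewrite card_prod card_ord.
have bound : INR n * (2 * / INR n ^ 4) <= 1 / INR n ^ 2.
  apply: (Rmult_le_reg_r (INR n ^ 3)); first by apply: pow_lt; lra.
  have -> : INR n * (2 * / INR n ^ 4) * INR n ^ 3 = 2 by field; lra.
  have -> : 1 / INR n ^ 2 * INR n ^ 3 = INR n by field; lra.
  lra.
apply: Rplus_le_compat_l; apply: Ropp_le_contravar; apply: Rle_trans bound.
have p1 := exp_pos (2 * (2 * Rad ^ 2) - 5 * Rad ^ 2).
have p2 := exp_pos (Rad ^ 2 / 36864 - Rad ^ 2 / 9216 / 2).
by apply: Rmult_le_compat => //; [exact: pos_INR | lra | lra].
Qed.
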